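(* Let $X$ be a crowded feebly compact $\pi$-regular space and let $\mu$ be a fixed (finite or infinite) cardinal. If $\Phi(\lambda,\mu)$ holds for all cardinals $\lambda<\widehat{c}(X)$, then $X$ is $\mu$-resolvable.
   Context: A topological space is crowded if it has no isolated points. A space $X$ is $\pi$-regular if it is Hausdorff and for every non-empty open set $U$ in $X$ there is a non-empty open set $V$ with $\overline{V}\subset U$. A space $X$ is feebly compact if every locally finite collection of open sets in $X$ is finite. For a cardinal $\mu$, $X$ is $\mu$-resolvable if it contains $\mu$ pairwise disjoint dense subsets. $\widehat{c}(X)$ denotes the smallest cardinal $\kappa$ such that $X$ does not contain $\kappa$ many pairwise disjoint non-empty open sets. For a cardinal $\lambda$, $\mathbb{B}(\lambda)=D(\lambda)^\omega$ denotes the Baire space of weight $\lambda$, i.e. the $\omega$th power (with the product topology) of the discrete space $D(\lambda)$ on $\lambda$. $\mathbb{C}=2^\omega$ is the Cantor set. $\Phi(\lambda,\mu)$ is the statement that there is a coloring $b:\mathbb{B}(\lambda)\to\mu$ such that $b[C]=\mu$ for every subspace $C\subset\mathbb{B}(\lambda)$ homeomorphic to $\mathbb{C}$ (every homeomorphic copy of the Cantor set picks up all $\mu$ colors). *)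

(* Defs.v *)
From HB Require Import structures.
From mathcomp Require Import all_boot all_order all_algebra.
From mathcomp Require Import all_classical all_reals all_analysis.

Set Implicit Arguments.
Unset Strict Implicit.
Unset Printing Implicit Defensive.

Local Open Scope classical_set_scope.
Local Open Scope card_scope.

(* A cardinal is represented by any type of that cardinality. The alias keeps
   all cardinals in one universe, which [hat_c_exists] below forces to contain
   [set X] for every topological space X. *)
Definition cardinal := Type.

Definition card_lt (L K : cardinal) : Prop :=
  ([set: L] #<= [set: K]) /\ ~ ([set: K] #<= [set: L]).

Lemma inj_card_leT (L K : Type) (f : L -> K) :
  injective f -> [set: L] #<= [set: K].
Proof.
move=> f_inj; have fE : f @` [set: L] #= [set: L].
  by apply: inj_card_eq => x y _ _; exact: f_inj.
by rewrite -(card_le_eql fE); exact: card_leT.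
Qed.

(* Any nonempty class of cardinals has a least element. *)
Lemma card_minT (I : Type) (i0 : I) (A : I -> Type) :
  exists i, forall j, exists f : A i -> A j, injective f.
Proof.
pose P (S : set (forall i, A i)) :=
  forall i f g, S f -> S g -> f i = g i -> f = g.
have [F FP Ftot|S [SP Smax]] := @Zorn_bigcup _ P.
  move=> i f g [B FB Bf] [C FC Cg]; have [BC|CB] := Ftot _ _ FB FC.
    by apply: (FP _ FC) => //; exact: BC.
  by apply: (FP _ FB) => //; exact: CB.
have [i Si] : exists i, forall a : A i, exists f, S f /\ f i = a.
  apply: contrapT => /forallNP noi.
  have out i : exists a : A i, forall f, S f -> f i <> a.
    have /existsNP[a aS] := noi i; exists a => f Sf fa; apply: aS.
    by exists f.
  pose g i := sval (cid (out i)).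
  have gS i f : S f -> f i <> g i by exact: (svalP (cid (out i))).
  apply: (Smax (g |` S)); last first.
    move=> i f h [->|Sf] [->|Sh] // fh; last exact: SP fh.
    - by case: (gS i h Sh).
    - by case: (gS i f Sf).
  split; first by move=> f Sf; right.
  by move=> /(_ g (or_introl erefl)) /(gS i0).
exists i => j; pose s a := sval (cid (Si a)).
have sP a : S (s a) /\ s a i = a by exact: (svalP (cid (Si a))).
exists (fun a => s a j) => a b sab.
have [Sa <-] := sP a; have [Sb <-] := sP b.
by rewrite (SP _ _ _ Sa Sb sab).
Qed.

Section Spaces.
Variable X : topologicalType.

Definition crowded : Prop := isolated [set: X] = set0.

Definition pi_regular : Prop :=
  hausdorff_space X /\
  forall U : set X, open U -> U !=set0 ->
    exists V : set X, [/\ open V, V !=set0 & closure V `<=` U].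

Definition locally_finite (F : set (set X)) : Prop :=
  forall x : X, exists2 V, nbhs x V &
    finite_set [set U | F U /\ U `&` V !=set0].

Definition feebly_compact : Prop :=
  forall F : set (set X),
    (forall U, F U -> open U) -> locally_finite F -> finite_set F.

(* The dense sets are given as a family indexed by mu; such a family is
   automatically injective unless X is empty. *)
Definition resolvable (mu : cardinal) : Prop :=
  exists D : mu -> set X, (forall i, dense (D i)) /\ trivIset [set: mu] D.

Definition has_cellular_family (K : cardinal) : Prop :=
  exists U : K -> set X,
    (forall k, open (U k) /\ U k !=set0) /\ trivIset [set: K] U.

Definition is_hat_c (K : cardinal) : Prop :=
  ~ has_cellular_family K /\
  forall L : cardinal, ~ has_cellular_family L -> [set: K] #<= [set: L].

Lemma hat_c_exists : exists K : cardinal, is_hat_c K.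
Proof.
have noX : ~ has_cellular_family (set X).
  move=> [U [Uo Utriv]]; pose p s := sval (cid (Uo s).2).
  have pU s : U s (p s) by exact: (svalP (cid (Uo s).2)).
  have p_inj s t : p s = p t -> s = t.
    by move=> st; apply: Utriv => //; exists (p s); split; rewrite // st.
  pose D : set X := [set x | exists2 s, x = p s & ~ s (p s)].
  have [DD|nDD] := pselect (D (p D)).
    by have [s /p_inj <-] := DD.
  by apply: (nDD); exists D.
pose small (A : set (set X)) := ~ has_cellular_family A.
have small_sub (L : Type) (f : L -> set X) : injective f ->
    ~ has_cellular_family L -> small (range f).
  move=> f_inj noL [U [Uo Utriv]]; apply: noL.
  pose h l : range f := exist _ (f l) (mem_set (imageT f l)).
  exists (U \o h); split=> [l|l m _ _ lm]; first exact: Uo.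
  by have /(congr1 val)/f_inj := Utriv _ _ I I lm.
have smallT : small (range (@id (set X))) by exact: small_sub noX.
have [[A noA] Amin] :=
  @card_minT {A | small A} (exist small _ smallT) (fun A => set_type (sval A)).
exists A; split=> // L noL.
have below f : @injective (set X) L f -> [set: A] #<= [set: L].
  move=> f_inj; have [k k_inj] := Amin (exist small _ (small_sub _ _ f_inj noL)).
  pose h (s : range f) := sval (cid2 (set_valP s)).
  have hP s : f (h s) = val s by rewrite /h; case: cid2.
  apply: (@inj_card_leT _ _ (h \o k)) => s t st; apply: k_inj; apply: val_inj.
  by rewrite -!hP [h _]st.
have [[] le] := @card_minT bool true (fun b => if b then L else set X).
  by have [f] := le false; exact: below.
have [f f_inj] := le true.
apply: (@inj_card_leT _ _ (f \o val)); exact: inj_comp f_inj val_inj.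
Qed.

Definition hat_c : cardinal := sval (cid hat_c_exists).

Lemma hat_cP : is_hat_c hat_c.
Proof. exact: (svalP (cid hat_c_exists)). Qed.

End Spaces.

Definition homeomorphic (Y Z : topologicalType) : Prop :=
  exists (f : Y -> Z) (g : Z -> Y),
    [/\ continuous f, continuous g, cancel f g & cancel g f].

(* [{classic L}] only equips L with the choice structure that the library
   requires of the points of a topological space. *)
Definition baire_space (L : cardinal) : topologicalType :=
  prod_topology (fun _ : nat => discrete_topology {classic L}).

(* [set_type C] carries the subspace topology. *)
Definition Phi (L mu : cardinal) : Prop :=
  exists b : baire_space L -> mu,
    forall C : set (baire_space L),
      homeomorphic (set_type C) cantor_space -> b @` C = [set: mu].

(* Main.v *)
Require Import Defs.
From mathcomp Require Import all_boot all_order all_algebra.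
From mathcomp Require Import all_classical all_reals all_analysis.
From mathcomp Require Import wochoice.

(* Resolvability is local, so one may work inside an open set O all of whose
   non-empty open subsets have cellular families of the same sizes as O; in such
   an O a countable union of cellular families has the size of a cellular
   family.

   By transfinite recursion choose levels L_a: L_a is a maximal disjoint family
   of non-empty regular open subsets of O that are properly included in members
   of every earlier level.  The rank of a point x is the first a with x not
   covered by L_a.  When the rank is the limit of a sequence a_n, the nodes of
   the levels a_n that contain x form a point of a Baire space of weight below
   hat_c X, and x gets the color of that point.

   Every non-empty open subset G of O has a non-empty open subset H missed by
   some level; if that level is the least possible over all choices of H, every
   earlier level is dense in H.  Hence, by maximality, every non-empty open
   subset of H meets two nodes of some earlier level, which yields a Cantor
   scheme of open sets V_s in H, with V_s0 and V_s1 in different nodes of the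
   same level a_|s|.  For a branch g, the sets V_s where s is a non-empty prefix
   of g with its last digit flipped are pairwise disjoint, so by feeble
   compactness they accumulate at some x_g.  This x_g lies in all V_(g|n), but in
   no node of a level above all the a_n, as such a node would miss all these
   sets.  So all the x_g have rank sup a_n, their branches form a Cantor set, and
   all colors appear in G. *)

Set Implicit Arguments.
Unset Strict Implicit.
Unset Printing Implicit Defensive.

Local Open Scope classical_set_scope.

(** * Well-orderings, Cantor's diagonal argument and maximal disjoint families *)

Section WellOrder.
Variables (W : Type) (lt : W -> W -> Prop).

Definition strict_well_order : Prop :=
  well_founded lt /\ forall a b, [\/ lt a b, a = b | lt b a].

Hypothesis wo : strict_well_order.

Lemma swo_min (P : set W) :
  P !=set0 -> exists a, P a /\ forall b, lt b a -> ~ P b.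
Proof.
case: wo => wf _ [a]; elim/(well_founded_ind wf): a => a IH Pa.
have [[b ba Pb]|no] := pselect (exists2 b, lt b a & P b); first exact: IH Pb.
by exists a; split=> // b ba Pb; apply: no; exists b.
Qed.

End WellOrder.

Lemma strict_well_order_exists (W : choiceType) :
  exists lt : W -> W -> Prop, strict_well_order lt.
Proof.
have [R Rwo] := well_ordering_principle W.
have mini (P : set W) : P !=set0 -> exists a, P a /\ forall b, P b -> R a b.
  move=> [x Px]; have [|a [[aP amin] _]] := Rwo [pred x | `[< P x >]].
    by exists x; apply/asboolP.
  exists a; split; first exact/asboolP.
  by move=> b Pb; apply: amin; apply/asboolP.
have Rrefl a : R a a.
  by have [|_ [-> ]] := mini [set a]; [exists a|apply].
(* Antisymmetry comes from the uniqueness of the minimum of the pair [a], [b]. *)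
have Ranti a b : R a b -> R b a -> a = b.
  move=> ab ba; have [|c [[[cab cmin] cuniq]]] := Rwo [pred x | (x == a) || (x == b)].
    by exists a; rewrite inE eqxx.
  have /cuniq <- : minimum_of R [pred x | (x == a) || (x == b)] a.
    by split=> [|y]; rewrite !inE ?eqxx // => /orP[]/eqP->.
  by apply: cuniq; split=> [|y]; rewrite !inE ?eqxx ?orbT // => /orP[]/eqP->.
have Rtot a b : R a b \/ R b a.
  have [|c [[]->]] := mini [set a; b]; first by exists a; left.
    by move=> /(_ b (or_intror erefl)); left.
  by move=> /(_ a (or_introl erefl)); right.
exists (fun a b => R a b /\ a <> b); split.
- move=> a; apply: contrapT => nAcc.
  have [|m [nAm mmin]] := mini [set x | ~ Acc (fun a b => R a b /\ a <> b) x].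
    by exists a.
  apply: nAm; constructor=> b [bm nbm]; apply: contrapT => nAb.
  by apply: nbm; apply: Ranti => //; exact: mmin.
- move=> a b; have [->|nab] := pselect (a = b); first by constructor 2.
  by have [] := Rtot a b; [constructor 1|constructor 3]; split=> // /esym.
Qed.

Lemma powerset_not_injective (T : Type) (f : set T -> T) : ~ injective f.
Proof.
move=> f_inj; pose D : set T := [set x | exists2 S, x = f S & ~ S x].
have [DD|nDD] := pselect (D (f D)); last by apply: (nDD); exists D.
by have [S /f_inj <-] := DD.
Qed.

(** Zorn's lemma: a non-empty [U] in [P] that missed all of [M] could be added to [M]. *)
Lemma maximal_disjoint_subfamily (T : Type) (P : set (set T)) :
  exists M : set (set T), [/\ M `<=` P, trivIset M id &
    forall U, P U -> U !=set0 -> exists2 V, M V & U `&` V !=set0].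
Proof.
pose Q (M : set (set T)) := M `<=` P /\ trivIset M id.
have [F FQ Ftot|M [[MP Mtriv] Mmax]] := @Zorn_bigcup _ Q.
  split=> [U [M FM MU]|U V [M FM MU] [N FN NV]]; first exact: (FQ _ FM).1.
  have [MN|NM] := Ftot _ _ FM FN; first by apply: (FQ _ FN).2 => //; exact: MN.
  by apply: (FQ _ FM).2 => //; exact: NM.
exists M; split=> // U PU U0; apply: contrapT => noV.
have MU V : M V -> U `&` V = set0.
  move=> MV; apply: contrapT => /eqP/set0P UV; apply: noV; by exists V.
apply: (Mmax (U |` M)).
  split; first by move=> V; right.
  move=> /(_ U (or_introl erefl)) /MU; rewrite setIid => U00.
  by move: U0; rewrite U00 => -[].
split=> [V [->|/MP]//|V V' [->|MV] [->|MV']] //=; last exact: Mtriv.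
  by rewrite MU// => -[].
by rewrite setIC MU// => -[].
Qed.

(** * Cellular families, local resolvability and consequences of the hypotheses on the space *)

Section Cellular.
Variable X : topologicalType.

Definition nonempty_open (U : set X) : Prop := open U /\ U !=set0.

Definition cellular_in (V : set X) (K : Type) : Prop :=
  exists C : K -> set X,
    (forall k, nonempty_open (C k) /\ C k `<=` V) /\ trivIset [set: K] C.

Lemma cellular_in_inj V (K L : Type) (f : K -> L) :
  injective f -> cellular_in V L -> cellular_in V K.
Proof.
move=> f_inj [C [CV Ctriv]]; exists (C \o f); split=> [k|k l _ _ kl].
  exact: CV.
by apply: f_inj; exact: Ctriv.
Qed.

(** The least non-cellular cardinal is the same for all non-empty open [V] inside [O]; quantifying
    over [K] avoids naming it. *)
Definition homogeneous (O : set X) : Prop :=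
  forall V, nonempty_open V -> V `<=` O ->
    forall K : Type, cellular_in O K -> cellular_in V K.

Lemma not_cellular_in_set V : ~ cellular_in V (set X).
Proof.
move=> [U [Uo Utriv]]; pose p s := sval (cid (Uo s).1.2).
have pU s : U s (p s) by exact: (svalP (cid (Uo s).1.2)).
apply: (@powerset_not_injective X p) => s t st.
by apply: Utriv => //; exists (p s); split; rewrite // st.
Qed.

(* Shrink to an open set at which the least cardinal that is not cellular is
   as small as possible. *)
Lemma homogeneous_subset (U : set X) :
  nonempty_open U ->
  exists O, [/\ nonempty_open O, O `<=` U & homogeneous O].
Proof.
move=> Uo.
(* Sizes are coded as subsets of [set X], since a cellular family has the size of its range; so
   [card_minT] can minimize over one type. *)
pose small (VA : set X * set (set X)) :=
  [/\ nonempty_open VA.1, VA.1 `<=` U & ~ cellular_in VA.1 (set_type VA.2)].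
have smallT : small (U, setT).
  split=> //= /(@cellular_in_inj _ _ _ (fun s => exist _ s (mem_set I))).
  move=> /= /(_ _)/not_cellular_in_set; apply.
  by move=> s t /(congr1 val).
have [[VA [Oo OU nOA]] Amin] :=
  @card_minT {VA | small VA} (exist _ _ smallT)
             (fun VA => set_type (sval VA).2).
case: VA Oo OU nOA Amin => O A /= Oo OU nOA Amin.
exists O; split=> // V Vo VO K [C [CO Ctriv]]; apply: contrapT => nVK.
have C_inj : injective C.
  move=> k l kl; apply: Ctriv => //; rewrite kl setIid.
  exact: (CO l).1.2.
pose g (s : range C) := sval (cid2 (set_valP s)).
have gP s : C (g s) = val s by rewrite /g; case: cid2.
have g_inj : injective g by move=> s t st; apply: val_inj; rewrite -!gP st.
have smallV : small (V, range C).
  split=> //=; first exact: subset_trans OU.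
  move=> /(@cellular_in_inj _ _ _ (fun k => exist _ (C k) (mem_set (imageT C k)))).
  by move=> VK; apply/nVK/VK => k l /(congr1 val)/C_inj.
(* Minimality injects [A] into [range C], hence into [K], which would make [A] cellular in [O]. *)
have [f f_inj] := Amin (exist _ _ smallV).
apply: nOA; apply: (@cellular_in_inj O _ _ (g \o f)); last by exists C.
exact: inj_comp f_inj.
Qed.

(** Countably many disjoint open sets [V n] fit in [O], and by homogeneity [V n] has room for a
    family of size [F n]. Each element of the union is placed in [V n] for one chosen [n]. *)
Lemma homogeneous_bigcup (O : set X) (F : nat -> set (set X)) :
  homogeneous O -> cellular_in O nat ->
  (forall n, cellular_in O (F n)) -> cellular_in O (\bigcup_n F n).
Proof.
move=> Oh [V [VO Vtriv]] FO.
have FV n : cellular_in (V n) (F n) by have [Vo VnO] := VO n; exact: Oh.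
pose C n := sval (cid (FV n)).
have CP n : (forall k, nonempty_open (C n k) /\ C n k `<=` V n) /\
    trivIset [set: F n] (C n) by exact: (svalP (cid (FV n))).
have /choice [n nP] : forall s : \bigcup_n F n, exists n, F n (val s).
  by move=> s; have [n _ Fn] := set_valP s; exists n.
exists (fun s => C (n s) (exist _ (val s) (mem_set (nP s)))).
split=> [s|s t _ _ [x [xs xt]]].
  have [Cs CV] := (CP (n s)).1 (exist _ (val s) (mem_set (nP s))).
  split=> //; apply: subset_trans CV _; exact: (VO _).2.
have nst : n s = n t.
  apply: Vtriv => //; exists x; split.
    by apply: ((CP (n s)).1 _).2; exact: xs.
  by apply: ((CP (n t)).1 _).2; exact: xt.
apply: val_inj; move: (nP s) (nP t) xs xt; rewrite nst => Ps Pt xs xt.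
pose u : F (n t) := exist _ (val s) (mem_set Ps).
pose v : F (n t) := exist _ (val t) (mem_set Pt).
have uv : u = v by apply: (CP (n t)).2 => //; exists x.
exact: (congr1 val uv).
Qed.

(** If [hat_c X] injected into [L], it would index a cellular family. Comparability of cardinals,
    which is [card_minT] over [bool], then gives the other inequality. *)
Lemma cellular_in_card_lt (V : set X) (L : cardinal) :
  cellular_in V L -> card_lt L (hat_c X).
Proof.
move=> [C [CV Ctriv]]; have [noc _] := hat_cP X.
have CL : has_cellular_family X L.
  by exists C; split=> // k; exact: (CV k).1.
have noinj (f : hat_c X -> L) : ~ injective f.
  move=> f_inj; apply: noc; have [D [Do Dtriv]] := CL.
  exists (D \o f); split=> [k|k l _ _ kl]; first exact: Do.
  by apply: f_inj; exact: Dtriv.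
split.
  have [b bmin] := @card_minT bool true (fun b => if b then L else hat_c X).
  case: b bmin => bmin.
    by have [f f_inj] := bmin false; exact: inj_card_leT f_inj.
  by have [f /noinj] := bmin true.
move=> /card_leP[f]; pose t k : [set: hat_c X] := exist _ k (mem_set I).
apply: (noinj (fun k => val (f (t k)))) => k l /val_inj/(@inj _ _ setT).
by rewrite !in_setT => /(_ isT isT)/(congr1 val).
Qed.

Definition resolvable_on (mu : cardinal) (O : set X) : Prop :=
  exists D : mu -> set X, [/\ forall i, D i `<=` O, trivIset [set: mu] D &
    forall i V, nonempty_open V -> V `<=` O -> V `&` D i !=set0].

(** The dense sets are glued over a maximal disjoint family of resolvable open sets; by maximality
    its union is dense. *)
Lemma resolvable_local (mu : cardinal) :
  (forall U, nonempty_open U -> exists O,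
     [/\ nonempty_open O, O `<=` U & resolvable_on mu O]) ->
  resolvable X mu.
Proof.
move=> loc.
have [M [MP Mtriv Mmax]] :=
  maximal_disjoint_subfamily [set O | nonempty_open O /\ resolvable_on mu O].
have /choice [D DP] : forall O, exists D : mu -> set X, M O ->
    [/\ forall i, D i `<=` O, trivIset [set: mu] D &
      forall i V, nonempty_open V -> V `<=` O -> V `&` D i !=set0].
  move=> O; have [/MP[_ [D DP]]|nMO] := pselect (M O); first by exists D.
  by exists (fun=> set0) => /nMO.
exists (fun i => \bigcup_(O in M) D O i); split=> [i U U0 Uo|i j _ _].
  have [G [Go GU Gr]] := loc U (conj Uo U0).
  have [|H MH GH] := Mmax G _ Go.2 => //.
  have [_ _ dD] := DP H MH; have [||x [[Gx _] Dx]] := dD i (G `&` H).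
  - by split=> //; apply: openI; [exact: Go.1|exact: (MP _ MH).1.1].
  - exact: subIsetr.
  - by exists x; split; [exact: GU|exists H].
move=> [x [[G MO Dx] [H MO' D'x]]].
have OO' : G = H.
  apply: Mtriv => //; exists x; have [DO _ _] := DP G MO.
  have [DO' _ _] := DP H MO'; split; [exact: DO Dx|exact: DO' D'x].
have [_ tr _] := DP G MO; apply: tr => //; exists x; split=> //.
by rewrite OO'.
Qed.

Hypothesis X_crowded : crowded X.

Lemma crowded_split (V : set X) : hausdorff_space X -> nonempty_open V ->
  exists A B, [/\ nonempty_open A, nonempty_open B, A `<=` V, B `<=` V &
    A `&` B = set0].
Proof.
move=> hX [Vo [x Vx]].
have [y Vy xy] : exists2 y, V y & x != y.
  apply: contrapT => noy; have : isolated [set: X] x.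
    split; first exact: in_setT.
    exists V; first exact: open_nbhs_nbhs.
    rewrite setIT; apply/seteqP; split=> [y Vy|_ ->//].
    by apply: contrapT => /eqP yx; apply: noy; exists y => //; rewrite eq_sym.
  by rewrite X_crowded.
move: hX; rewrite open_hausdorff => /(_ x y xy) [[A B] /= [Ax By] [Ao Bo AB]].
exists (A `&` V), (B `&` V); split.
- by split; [exact: openI|exists x; split; first exact: set_mem].
- by split; [exact: openI|exists y; split; first exact: set_mem].
- exact: subIsetr.
- exact: subIsetr.
- by rewrite setIACA (eqP AB) set0I.
Qed.

(** Split repeatedly, keeping the first piece and splitting the second. *)
Lemma cellular_in_nat (O : set X) :
  hausdorff_space X -> nonempty_open O -> cellular_in O nat.
Proof.
move=> hX Oo.
have /choice [S SP] : forall V, exists AB : set X * set X, nonempty_open V ->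
    [/\ nonempty_open AB.1, nonempty_open AB.2, AB.1 `<=` V, AB.2 `<=` V &
      AB.1 `&` AB.2 = set0].
  move=> V; have [Vo|nV] := pselect (nonempty_open V); last by exists (V, V) => /nV.
  by have [A [B AB]] := crowded_split hX Vo; exists (A, B).
pose V n := iter n (fun V => (S V).2) O.
have Vo n : nonempty_open (V n).
  by elim: n => [//|n IH]; have [] := SP _ IH.
have VS n : V n.+1 `<=` V n by have [] := SP _ (Vo n).
have Vle m n : (m <= n)%N -> V n `<=` V m.
  move=> /subnK<-; elim: (n - m)%N => [//|k IH].
  exact: subset_trans (VS _) IH.
exists (fun n => (S (V n)).1); split=> [n|].
  have [? _ ? _ _] := SP _ (Vo n); split=> //.
  by apply: (@subset_trans _ (V n)) => //; exact: (Vle 0%N).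
apply: ltn_trivIset => n m mn; apply/seteqP; split=> // x [xm xn].
have [_ _ nV _ _] := SP _ (Vo n); have [_ _ _ _ <-] := SP _ (Vo m).
by split=> //; apply: (Vle m.+1 n mn); exact: nV.
Qed.

Hypothesis X_pi : pi_regular X.

(** For disjoint open [A] and [B] in [V], pi-regularity gives [W] with closure in [A]; the interior
    of that closure is regular open and misses [B]. *)
Lemma regopen_proper_subset (V : set X) : nonempty_open V ->
  exists U, [/\ nonempty_open U, regopen U, U `<=` V & V != U].
Proof.
case: X_pi => hX pX Vo.
have [A [B [[Ao A0] [_ [y By]] AV BV AB]]] := crowded_split hX Vo.
have [W [Wo W0 WA]] := pX _ Ao A0.
exists (closure W)°; split.
- split; first exact: open_interior.
  have [x Wx] := W0; exists x; apply: (interiorS (@subset_closure _ W)).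
  by rewrite (interior_id W).1.
- by rewrite /regopen interior_closed_regopen //; exact: closed_closure.
- apply: subset_trans AV; apply: subset_trans WA; exact: interior_subset.
- apply/eqP => VW; suff : (A `&` B) y by rewrite AB.
  split=> //; apply: WA; apply: interior_subset; rewrite -VW; exact: BV.
Qed.

Hypothesis X_fc : feebly_compact X.

(** Without such a point [range E] would be locally finite, hence finite, although [E] is
    injective. *)
Lemma feebly_compact_accumulation (E : nat -> set X) :
  (forall n, nonempty_open (E n)) -> trivIset [set: nat] E ->
  exists x : X, forall G : set X, nbhs x G ->
    forall m, exists2 n, (m <= n)%N & G `&` E n !=set0.
Proof.
move=> Eo Etriv; apply: contrapT => /forallNP noacc.
have E_inj : injective E.
  by move=> m n mn; apply: Etriv => //; rewrite mn setIid; exact: (Eo n).2.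
apply: infinite_nat; rewrite -(@eq_finite_set _ _ (range E)); last first.
  by apply: inj_card_eq => m n _ _; exact: E_inj.
apply: X_fc => [_ [n _ <-]|x]; first exact: (Eo n).1.
have /existsNP[G /not_implyP[xG /existsNP[m mP]]] := noacc x.
exists G => //; apply: (@sub_finite_set _ _ (E @` `I_m)); last first.
  exact: finite_image (finite_II m).
move=> _ [[n _ <-] EG]; exists n => //=; rewrite ltnNge; apply/negP => mn.
by apply: mP; exists n => //; rewrite setIC.
Qed.

End Cellular.

(** * Cantor sets in Baire spaces, in terms of sequences *)

Lemma continuous_into_prod (T : topologicalType) (K : nat -> topologicalType)
    (f : T -> prod_topology K) :
  (forall n, continuous (fun x => f x n)) -> continuous f.
Proof.
move=> fc x; apply/cvg_sup => n; move: x.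
exact: (@continuous_comp_initial _ _ _ (fun g : prod_topology K => g n)).
Qed.

Lemma continuous_into_discrete (T : topologicalType)
    (D : discreteTopologicalType) (f : T -> D) :
  (forall x, nbhs x [set y | f y = f x]) -> continuous f.
Proof. by move=> fx x; apply/discrete_cvg; exact: fx. Qed.

Lemma nbhs_prod_coord (D : nat -> discreteTopologicalType)
    (f : prod_topology D) n : nbhs f [set g : prod_topology D | g n = f n].
Proof.
apply: (@proj_continuous _ D n f [set y | y = f n]).
exact: discrete_set1.
Qed.

Lemma nbhs_prod_prefix (D : nat -> discreteTopologicalType)
    (f : prod_topology D) m :
  nbhs f [set g : prod_topology D | forall k, (k < m)%N -> g k = f k].
Proof.
elim: m => [|m IH]; first by apply: filterS filterT => g.
apply: filterS (filterI IH (nbhs_prod_coord f m)) => g /= [gm gfm] k.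
by rewrite ltnS leq_eqVlt => /orP[/eqP->//|/gm].
Qed.

(** The two conditions with [m] make [h] an embedding of the Cantor space, so [Phi] applies to its
    range. Colors are sets with at most one element, so that sequences leaving [A] need none, even
    when [mu] is empty. *)
Lemma Phi_coloring (S : Type) (A : set S) (mu : cardinal) :
  Phi (set_type A) mu ->
  exists b : (nat -> S) -> set mu,
    (forall f i j, b f i -> b f j -> i = j) /\
    forall h : (nat -> bool) -> nat -> S,
      (forall g n, A (h g n)) ->
      (forall n, exists m, forall g g',
         (forall k, (k < m)%N -> g k = g' k) -> h g n = h g' n) ->
      (forall k, exists m, forall g g',
         (forall n, (n < m)%N -> h g n = h g' n) -> g k = g' k) ->
      forall i, exists g, b (h g) i.
Proof.
move=> [b0 b0P].
pose b (f : nat -> S) : set mu := [set i | exists u : nat -> set_type A,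
  (forall n, val (u n) = f n) /\ b0 u = i].
exists b; split.
  move=> f _ _ [u [uf <-]] [v [vf <-]]; congr b0; apply/funext => n.
  by apply: val_inj; rewrite uf vf.
move=> h hA hc hi i.
pose u (g : cantor_space) : baire_space (set_type A) :=
  fun n => exist _ (h g n) (mem_set (hA g n)).
have uE g n : val (u g n) = h g n by [].
pose C := range u.
pose F (g : cantor_space) : set_type C := exist _ (u g) (mem_set (imageT u g)).
pose G (c : set_type C) : cantor_space := sval (cid2 (set_valP c)).
have GP c : u (G c) = val c by rewrite /G; case: cid2.
have u_inj g g' : u g = u g' -> g = g'.
  move=> gg'; apply/funext => k; have [m] := hi k.
  by apply=> n _; rewrite -!uE gg'.
have hom : homeomorphic (set_type C) cantor_space.
  exists G, F; split.
  - apply: continuous_into_prod => k; apply: continuous_into_discrete => c.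
    have [m mP] := hi k.
    have /filterS : nbhs c [set c' : set_type C |
        forall n, (n < m)%N -> val c' n = val c n].
      apply: (@initial_continuous _ _ (@set_val _ C) c
        [set f | forall n, (n < m)%N -> f n = val c n]).
      exact: (@nbhs_prod_prefix
        (fun=> discrete_topology {classic (set_type A)}) (val c) m).
    apply; move=> c' /= c'c; apply: mP => n /c'c.
    by rewrite -!GP => /(congr1 val).
  - apply: continuous_comp_initial; apply: continuous_into_prod => n.
    apply: continuous_into_discrete => g; have [m mP] := hc n.
    apply: filterS (nbhs_prod_prefix g m) => g' g'g.
    by apply: val_inj; exact: mP.
  - by move=> c; apply: val_inj; exact: GP.
  - by move=> g; apply: u_inj; rewrite GP.
have : (b0 @` C) i by rewrite b0P.
by move=> [_ [g _ <-] <-]; exists g, (u g).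
Qed.

(** * The transfinite tree of levels *)

Section Levels.
Variables (X : topologicalType) (W : Type) (lt : W -> W -> Prop).
Hypothesis lt_wo : strict_well_order lt.
Variable O : set X.

(** Proper inclusion makes the levels die out in [empty_level]; regular openness turns density into
    inclusion in [splits_exists]. *)
Definition level_candidate (L : W -> set (set X)) (a : W) : set (set X) :=
  [set U | [/\ nonempty_open U, regopen U, U `<=` O &
    forall b, lt b a -> exists2 U', L b U' & U `<=` U' /\ U != U']].

Definition is_levels (L : W -> set (set X)) : Prop :=
  forall a, [/\ L a `<=` level_candidate L a, trivIset (L a) id &
    forall U, level_candidate L a U -> exists2 V, L a V & U `&` V !=set0].

Lemma levels_exist : exists L, is_levels L.
Proof.
have [wf _] := lt_wo.
pose cand a (f : forall b, lt b a -> set (set X)) : set (set X) :=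
  [set U | [/\ nonempty_open U, regopen U, U `<=` O &
    forall b (ba : lt b a), exists2 U', f b ba U' & U `<=` U' /\ U != U']].
pose step a f := sval (cid (maximal_disjoint_subfamily (@cand a f))).
pose L := Fix wf (fun _ => set (set X)) step.
have LE a : L a = step a (fun b _ => L b).
  rewrite /L Fix_eq // => {}a f g fg; congr (step a _).
  by apply: functional_extensionality_dep => b; apply: functional_extensionality_dep.
exists L => a; rewrite LE /step; case: cid => M /= [Mc Mtriv Mmax].
split=> // U Uc; apply: Mmax => //; by case: Uc => -[].
Qed.

Variable L : W -> set (set X).
Hypothesis LP : is_levels L.

Lemma level_open a U : L a U -> nonempty_open U.
Proof. by move=> LU; have [/(_ _ LU)[]] := LP a. Qed.

Lemma level_sub a U : L a U -> U `<=` O.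
Proof. by move=> LU; have [/(_ _ LU)[]] := LP a. Qed.

Lemma level_uniq a U V x : L a U -> L a V -> U x -> V x -> U = V.
Proof.
by move=> LU LV Ux Vx; have [_ tr _] := LP a; apply: tr => //; exists x.
Qed.

Lemma level_refine b a U :
  lt b a \/ b = a -> L a U -> exists2 U', L b U' & U `<=` U'.
Proof.
move=> [ba LU|->]; last by exists U.
by have [/(_ _ LU)[_ _ _ /(_ b ba)[U' LU' [UU' _]]]] := LP a; exists U'.
Qed.

Lemma cellular_in_level a : cellular_in O (L a).
Proof.
exists val; split=> [U|U V _ _ [x [Ux Vx]]].
  by split; [exact: level_open (set_valP U)|exact: level_sub (set_valP U)].
apply: val_inj; exact: level_uniq (set_valP U) (set_valP V) Ux Vx.
Qed.

Hypothesis W_big : forall f : W -> set X, ~ injective f.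

(** Otherwise choosing a member of each level would inject [W] into [set X]: by disjointness of
    [L a], a set chosen both at [a] and at a later [b] would be a proper subset of itself. *)
Lemma empty_level : exists a, L a = set0.
Proof.
apply: contrapT => noa.
have /choice [f fL] : forall a, exists U, L a U.
  move=> a; apply: contrapT => noU; apply: noa; exists a.
  by apply/seteqP; split=> // U LU; apply: noU; exists U.
have no a b : lt a b -> f a = f b -> False.
  move=> ab fab; have [/(_ _ (fL b))[[_ [x bx]] _ _ /(_ a ab)[U LU [bU bNU]]]] := LP b.
  move: bNU; rewrite -fab (level_uniq (fL a) LU (x := x)) ?eqxx//; last exact: bU.
  by rewrite fab.
apply: (W_big (f := f)) => a b fab; have [_ tot] := lt_wo.
by have [/no/(_ fab)|//|/no/(_ (esym fab))] := tot a b.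
Qed.

(** An empty level shows that such an [a] exists. It is minimized over all open subsets of [V]
    together, so no earlier level can miss an open [H] inside [G]. *)
Lemma dying_subset V : nonempty_open V ->
  exists a G, [/\ nonempty_open G, G `<=` V,
    forall U, L a U -> U `&` G = set0 &
    forall b H, lt b a -> nonempty_open H -> H `<=` G ->
      exists2 U, L b U & U `&` H !=set0].
Proof.
move=> Vo.
have [|a [[G [Go GV Ga]] amin]] := swo_min lt_wo (P := [set a |
    exists G, [/\ nonempty_open G, G `<=` V & forall U, L a U -> U `&` G = set0]]).
  by have [a La] := empty_level; exists a, V; split=> // U; rewrite La.
exists a, G; split=> // b H ba Ho HG; apply: contrapT => noU.
apply: (amin b ba); exists H; split=> //; first exact: subset_trans GV.
move=> U LU; apply: contrapT => /eqP/set0P UH; apply: noU; by exists U.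
Qed.

Definition splits_at (a : W) (V : set X) : Prop :=
  exists N1 N2, [/\ L a N1, L a N2, N1 != N2, N1 `&` V !=set0 & N2 `&` V !=set0].

Hypotheses (X_crowded : crowded X) (X_pi : pi_regular X) (X_fc : feebly_compact X).

(** * A Cantor scheme in an open set missed by level [c] *)

Section Scheme.
Variables (c : W) (G : set X).
Hypotheses (GO : G `<=` O).
Hypothesis G_dead : forall U, L c U -> U `&` G = set0.
Hypothesis G_dense : forall b H, lt b c -> nonempty_open H -> H `<=` G ->
  exists2 U, L b U & U `&` H !=set0.

(** If no earlier level split [H], each would have a member containing [H]. A regular open proper
    subset of [H] would then be a candidate for level [c], and by maximality [L c] would meet
    [G]. *)
Lemma splits_exists H : nonempty_open H -> H `<=` G ->
  exists2 b, lt b c & splits_at b H.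
Proof.
move=> Ho HG; apply: contrapT => nosplit.
have [U [Uo Ur UH HU]] := regopen_proper_subset X_crowded X_pi Ho.
have [V LV [x [Ux Vx]]] : exists2 V, L c V & U `&` V !=set0; last first.
  suff : (V `&` G) x by rewrite G_dead.
  by split=> //; apply: HG; exact: UH.
have [_ _] := LP c; apply; split=> //.
  by apply: subset_trans GO; exact: subset_trans HG.
move=> b bc; have [N LN NH] := G_dense bc Ho HG.
have [[No N0] Nr _ _] : level_candidate L b N by have [/(_ _ LN)] := LP b.
(* If [H] had a point outside [closure N], density of level [b] would give a second member meeting
   [H]. So [H] lies in [closure N], and in [N] by regular openness. *)
have HN : H `<=` N.
  rewrite -Nr -open_subsetE; last exact: Ho.1.
  apply: contrapT => /existsNP[x /not_implyP[Hx nNx]].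
  have [||V LV [y [Vy [Hy nNy]]]] := G_dense bc (H := H `&` ~` closure N).
  - split; last by exists x.
    by apply: openI; [exact: Ho.1|exact/closed_openC/closed_closure].
  - by move=> y [/HG].
  apply: nosplit; exists b => //; exists N, V; split=> //; last by exists y.
  by apply/eqP => NV; apply/nNy/subset_closure; rewrite NV.
exists N => //; split; first exact: subset_trans HN.
apply/eqP => UN; move/eqP: HU; apply.
by apply/seteqP; split=> //; rewrite UN.
Qed.

(** Inside each of the two members meeting [H], density gives a member of the later level that meets
    [H]. *)
Lemma splits_mono b b' H : lt b b' -> lt b' c -> nonempty_open H -> H `<=` G ->
  splits_at b H -> splits_at b' H.
Proof.
move=> bb' b'c [Ho H0] HG [N1 [N2 [L1 L2 N12 H1 H2]]].
have below N : L b N -> N `&` H !=set0 ->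
    exists N', [/\ L b' N', N' `<=` N & N' `&` H !=set0].
  move=> LN NH; have [||N' LN' [x [N'x [Nx Hx]]]] := G_dense b'c (H := N `&` H).
  - by split=> //; apply: openI => //; exact: (level_open LN).1.
  - by move=> x [_ /HG].
  exists N'; split=> //; last by exists x.
  have [N'' LN'' N'N''] := level_refine (or_introl bb') LN'.
  by rewrite (level_uniq LN LN'' Nx) //; exact: N'N''.
have [N1' [L1' N11 H1']] := below _ L1 H1.
have [N2' [L2' N22 H2']] := below _ L2 H2.
exists N1', N2'; split=> //; apply/eqP => E; move/eqP: N12; apply.
have [_ [x x1]] := level_open L1'.
by apply: (level_uniq L1 L2 (x := x)); [exact: N11|apply: N22; rewrite -E].
Qed.

(** By [splits_mono] the latest of the individual levels serves all the sets. The list is non-empty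
    so that some [b] below [c] exists. *)
Lemma splits_all (H0 : set X) (s : seq (set X)) :
  (forall H, H \in H0 :: s -> nonempty_open H /\ H `<=` G) ->
  exists2 b, lt b c & forall H, H \in H0 :: s -> splits_at b H.
Proof.
elim: s H0 => [|H1 s IH] H0 Hs.
  have [|Ho HG] := Hs H0; first by rewrite mem_head.
  have [b bc bH] := splits_exists Ho HG; exists b => // H.
  by rewrite inE => /eqP->.
have [|b bc bs] := IH H1; first by move=> H Hin; apply: Hs; rewrite inE Hin orbT.
have [|Ho HG] := Hs H0; first by rewrite mem_head.
have [b' b'c b'H] := splits_exists Ho HG.
have [_ tot] := lt_wo; have [bb'|bb'|b'b] := tot b b'.
- exists b' => // H; rewrite inE => /predU1P[->//|Hin].
  have [Ho' HG'] : nonempty_open H /\ H `<=` G by apply: Hs; rewrite inE Hin orbT.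
  by apply: (splits_mono bb') => //; exact: bs.
- by exists b => // H; rewrite inE => /predU1P[->|/bs//]; rewrite bb'.
- exists b => // H; rewrite inE => /predU1P[->|/bs//].
  exact: (splits_mono b'b).
Qed.

Lemma scheme_step n (F : seq bool -> set X) :
  (forall s, nonempty_open (F s) /\ F s `<=` G) ->
  exists (b : W) (F' N : seq bool -> set X),
    [/\ lt b c, forall s, nonempty_open (F' s) /\ F' s `<=` G,
      forall s e, size s = n ->
        [/\ closure (F' (e :: s)) `<=` F s, L b (N (e :: s)) &
            F' (e :: s) `<=` N (e :: s)] &
      forall s, size s = n -> N (true :: s) != N (false :: s)].
Proof.
move=> FG.
(* [F [::]] merely supplies the head of the list; the tuples enumerate all words of length [n]. *)
have [b bc bP] : exists2 b, lt b c & forall s, size s = n -> splits_at b (F s).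
  have [|b bc bs] := @splits_all (F [::])
      [seq F (val t) | t <- enum {: n.-tuple bool}].
    by move=> H; rewrite inE => /predU1P[->|/mapP[t _ ->]].
  exists b => // s /eqP sn; apply: bs; rewrite inE; apply/orP; right.
  by apply/mapP; exists (Tuple sn) => //; rewrite mem_enum.
have /choice [D DP] : forall s, exists D : bool -> set X * set X, size s = n ->
    (forall e, [/\ nonempty_open (D e).1, closure (D e).1 `<=` F s, L b (D e).2 &
      (D e).1 `<=` (D e).2]) /\ (D true).2 != (D false).2.
  move=> s; have [sn|] := pselect (size s = n); last by exists (fun=> (set0, set0)).
  have [N1 [N2 [L1 L2 N12 H1 H2]]] := bP s sn.
  have shrink N : L b N -> N `&` F s !=set0 -> exists D,
      [/\ nonempty_open D, closure D `<=` F s & D `<=` N].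
    move=> LN NF; have [_ /(_ (N `&` F s))] := X_pi.
    case=> // [|D [Do D0 DN]].
      by apply: openI; [exact: (level_open LN).1|exact: (FG s).1.1].
    exists D; split=> //; first by apply: subset_trans DN _; exact: subIsetr.
    apply: subset_trans (@subset_closure _ D) _.
    by apply: subset_trans DN _; exact: subIsetl.
  have [D1 [D1o D1F D1N]] := shrink _ L1 H1.
  have [D2 [D2o D2F D2N]] := shrink _ L2 H2.
  by exists (fun e => if e then (D1, N1) else (D2, N2)) => _; split=> // -[].
(* On words of other lengths [F [::]] is a default that stays open, non-empty and inside [G]. *)
exists b, (fun t => if t is e :: s then if size s == n then (D s e).1 else F [::]
                    else F [::]),
  (fun t => if t is e :: s then (D s e).2 else set0); split=> //.
- case=> [|e s]; first exact: FG.
  case: eqP => [sn|_]; last exact: FG.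
  have [/(_ e)[? DF _ _] _] := DP s sn; split=> //.
  apply: subset_trans (FG s).2; apply: subset_trans DF; exact: subset_closure.
- by move=> s e sn; rewrite sn eqxx; have [/(_ e)[]] := DP s sn.
- by move=> s sn; have [] := DP s sn.
Qed.

Lemma cantor_scheme : nonempty_open G ->
  exists (V N : seq bool -> set X) (a : nat -> W),
    [/\ forall s, nonempty_open (V s) /\ V s `<=` G,
      forall n, lt (a n) c,
      forall e s, closure (V (e :: s)) `<=` V s,
      forall e s, L (a (size s)) (N (e :: s)) /\ V (e :: s) `<=` N (e :: s) &
      forall s, N (true :: s) != N (false :: s)].
Proof.
move=> Go.
pose good (F : seq bool -> set X) := forall s, nonempty_open (F s) /\ F s `<=` G.
have /choice [S SP] : forall nF : nat * (seq bool -> set X), exists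
    bFN : W * (seq bool -> set X) * (seq bool -> set X), good nF.2 ->
    [/\ lt bFN.1.1 c, good bFN.1.2,
      forall s e, size s = nF.1 ->
        [/\ closure (bFN.1.2 (e :: s)) `<=` nF.2 s, L bFN.1.1 (bFN.2 (e :: s)) &
            bFN.1.2 (e :: s) `<=` bFN.2 (e :: s)] &
      forall s, size s = nF.1 -> bFN.2 (true :: s) != bFN.2 (false :: s)].
  move=> [n F] /=; have [Fg|nFg] := pselect (good F).
    by have [b [F' [N bFN]]] := scheme_step n Fg; exists (b, F', N).
  by exists (c, F, F) => /nFg.
pose F := fix F n := if n is m.+1 then (S (m, F m)).1.2 else fun=> G.
have Fg n : good (F n).
  by elim: n => [s|n IH]; [split|have [] := SP (n, F n) IH].
(* The step from stage [m] chooses the nodes of the words of length [m.+1], hence the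
   predecessor. *)
exists (fun s => F (size s) s), (fun s => (S ((size s).-1, F (size s).-1)).2 s),
  (fun n => (S (n, F n)).1.1).
split=> [s|n|e s|e s|s]; first exact: Fg.
- by have [] := SP (n, F n) (Fg n).
- by have [_ _ /(_ s e erefl)[]] := SP (size s, F (size s)) (Fg _).
- by have [_ _ /(_ s e erefl)[]] := SP (size s, F (size s)) (Fg _).
- by have [_ _ _ /(_ s erefl)] := SP (size s, F (size s)) (Fg _).
Qed.

End Scheme.

(* [prefix g n] lists the first [n] values of [g] in reverse order. *)
Fixpoint prefix (g : nat -> bool) n : seq bool :=
  if n is m.+1 then g m :: prefix g m else [::].

Lemma size_prefix g n : size (prefix g n) = n.
Proof. by elim: n => //= n ->. Qed.

Lemma eq_prefix g g' n : (forall k, (k < n)%N -> g k = g' k) ->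
  prefix g n = prefix g' n.
Proof.
elim: n => //= n IH gg'; rewrite gg'// IH// => k kn.
by apply: gg'; exact: ltnW.
Qed.

(* [a] plays the role of the length of the branch of the tree through [x]. *)
Definition has_rank (x : X) (a : W) : Prop :=
  (forall U, L a U -> ~ U x) /\ forall b, lt b a -> exists2 U, L b U & U x.

Lemma has_rank_uniq x a b : has_rank x a -> has_rank x b -> a = b.
Proof.
move=> [xa xlta] [xb xltb]; have [_ tot] := lt_wo.
by have [/xltb[U /xa]|//|/xlta[U /xb]] := tot a b.
Qed.

Lemma cantor_branches G : nonempty_open G -> G `<=` O ->
  exists (x : (nat -> bool) -> X) (N : seq bool -> set X) (a : nat -> W) (c : W),
    [/\ forall g, G (x g) /\ has_rank (x g) c,
      forall n, lt (a n) c, forall b, lt b c -> exists n, lt b (a n) \/ b = a n,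
      forall g n, L (a n) (N (prefix g n.+1)) /\ N (prefix g n.+1) (x g) &
      forall s, N (true :: s) != N (false :: s)].
Proof.
move=> Go GO; have [c0 [H [Ho HG H_dead H_dense]]] := dying_subset Go.
have [V [N [a [Vo ac Vcl VN NN]]]] :=
  cantor_scheme (subset_trans HG GO) H_dead H_dense Ho.
have Vsub e s : V (e :: s) `<=` V s.
  by apply: subset_trans (Vcl e s); exact: subset_closure.
have Vle g m n : (m <= n)%N -> V (prefix g n) `<=` V (prefix g m).
  move=> /subnK<-; elim: (n - m)%N => [//|k IH].
  by apply: subset_trans IH; exact: Vsub.
(* The level [c0] may lie beyond the supremum of the [a n]; the common rank is the supremum [c], in
   which they are cofinal. *)
have [c [cge cmin]] := swo_min lt_wo (P := [set c | forall n, lt (a n) c])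
  (ex_intro _ c0 ac).
have ccof b : lt b c -> exists n, lt b (a n) \/ b = a n.
  move=> /cmin/existsNP[n nan]; exists n; have [_ tot] := lt_wo.
  by have [|->|] := tot b (a n); [left|right|].
have Nneg g n : N (~~ g n :: prefix g n) != N (prefix g n.+1).
  by rewrite /=; case: (g n) => /=; rewrite ?NN// eq_sym NN.
have LN e g n : L (a n) (N (e :: prefix g n)).
  by have := (VN e (prefix g n)).1; rewrite size_prefix.
pose E g n := V (~~ g n :: prefix g n).
have Etriv g : trivIset [set: nat] (E g).
  apply: ltn_trivIset => n m mn; apply/seteqP; split=> // x [Em En].
  move/eqP: (Nneg g m); apply; apply: (level_uniq (LN _ _ _) (LN _ _ _) (x := x)).
    exact: (VN _ _).2 Em.
  by apply: (VN _ _).2; apply: (Vle g m.+1 n mn); exact: Vsub En.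
have /choice [x xP] : forall g, exists x : X, forall U : set X, nbhs x U ->
    forall m, exists2 n, (m <= n)%N & U `&` E g n !=set0.
  move=> g; apply: feebly_compact_accumulation => // n; exact: (Vo _).1.
have xV g n : V (prefix g n) (x g).
  apply: (Vcl (g n)); change (closure (V (prefix g n.+1)) (x g)) => U xU.
  have [m nm [y [Uy Ey]]] := xP g U xU n.+1; exists y; split=> //.
  by apply: Vle nm _ _; exact: Vsub Ey.
have xN g n : N (prefix g n.+1) (x g) by exact: (VN _ _).2 (xV g n.+1).
exists x, N, a, c; split=> // [g|g n]; last by split; [exact: LN|exact: xN].
split; first exact/HG/(Vo _).2/(xV g 0%N).
split=> [U LU Ux|b /ccof[n bn]].
  (* A member of [L c] through [x g] would meet some [E g n], yet lie in a single member of level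
     [a n], which would be both the node on the branch and its sibling. *)
  have [|n _ [y [Uy Ey]]] := xP g U _ 0%N.
    by apply: open_nbhs_nbhs; split=> //; exact: (level_open LU).1.
  have [U' LU' UU'] := level_refine (or_introl (cge n)) LU.
  move/eqP: (Nneg g n); apply.
  rewrite -(level_uniq LU' (LN (g n) g n) (UU' _ Ux) (xN g n)).
  by apply/esym; apply: (level_uniq LU' (LN _ _ _) (UU' _ Uy)); exact: (VN _ _).2 Ey.
have [U' LU' NU'] := level_refine bn (LN (g n) g n).
by exists U' => //; apply: NU'; exact: xN.
Qed.

(** * Coloring the points by their branches *)

Definition cofinal_in (c : W) (a : nat -> W) : Prop :=
  (forall n, lt (a n) c) /\ forall b, lt b c -> exists n, lt b (a n) \/ b = a n.

Definition node (a : W) (x : X) : set X :=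
  [set y | exists U, [/\ L a U, U x & U y]].

Lemma nodeE a U x : L a U -> U x -> node a x = U.
Proof.
move=> LU Ux; apply/seteqP; split=> [y [V [LV Vx Vy]]|y Uy]; last by exists U.
by rewrite (level_uniq LU LV Ux Vx).
Qed.

Hypothesis O_open : nonempty_open O.
Hypothesis O_homogeneous : homogeneous O.

(** The color must be read along a sequence that depends only on the rank [c], so one cofinal
    sequence per rank is fixed in advance. It need not be the sequence [a] of the Cantor scheme;
    comparing the two cofinal sequences transfers the Cantor set. *)
Lemma levels_resolvable_on (mu : cardinal) :
  (forall K : cardinal, card_lt K (hat_c X) -> Phi K mu) -> resolvable_on mu O.
Proof.
move=> PhiX.
have [hX _] := X_pi.
have coloring (c : W) : exists ab : (nat -> W) * ((nat -> set X) -> set mu),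
    (forall f i j, ab.2 f i -> ab.2 f j -> i = j) /\
    ((exists a, cofinal_in c a) -> cofinal_in c ab.1 /\
    forall h : (nat -> bool) -> nat -> set X,
      (forall g n, L (ab.1 n) (h g n)) ->
      (forall n, exists m, forall g g',
         (forall k, (k < m)%N -> g k = g' k) -> h g n = h g' n) ->
      (forall k, exists m, forall g g',
         (forall n, (n < m)%N -> h g n = h g' n) -> g k = g' k) ->
      forall i, exists g, ab.2 (h g) i).
  have [[a ac]|noa] := pselect (exists a, cofinal_in c a); last first.
    by exists (fun=> c, fun=> set0); split=> // /noa.
  (* The alphabet is a countable union of levels; homogeneity keeps its size below [hat_c X]. *)
  have [|b [b_uniq bP]] := @Phi_coloring _ (\bigcup_n L (a n)) mu.
    apply/PhiX/cellular_in_card_lt/(homogeneous_bigcup O_homogeneous).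
      exact: cellular_in_nat.
    by move=> n; exact: cellular_in_level.
  exists (a, b); split=> // _; split=> // h hL; apply: bP => g n.
  by exists n.
have {coloring} /choice [ab abP] := coloring.
pose branch c x n := node ((ab c).1 n) x.
exists (fun i => [set x | O x /\ exists2 c, has_rank x c & (ab c).2 (branch c x) i]).
split=> [i x []//|i j _ _ [x [[_ [c xc ci]] [_ [c' xc' cj]]]]|i G Go GO].
  move: cj; rewrite -(has_rank_uniq xc xc') => cj.
  exact: (abP c).1 ci cj.
have [x [N [a [c [xc ac acof NL NN]]]]] := cantor_branches Go GO.
have [|[bc bcof] ci] := (abP c).2; first by exists a.
pose h g := branch c (x g).
have hP g n U : L ((ab c).1 n) U -> U (x g) -> h g n = U by exact: nodeE.
have [||| g gi] := ci h _ _ _ i; last first.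
- exists (x g); split; first exact: (xc g).1.
  by split; [exact/GO/(xc g).1|exists c => //; exact: (xc g).2].
(* Digit [k] is recovered by strong induction: the member at a level [bc n] not before [a k]
   determines the one at level [a k], where, once [prefix g k] is known, the two siblings differ. *)
- elim/ltn_ind => k IH.
  have {IH} [M MP] : exists M, forall g g',
      (forall n, (n < M)%N -> h g n = h g' n) -> forall j, (j < k)%N -> g j = g' j.
    have /choice [m mP] : forall j, exists m, (j < k)%N -> forall g g',
        (forall n, (n < m)%N -> h g n = h g' n) -> g j = g' j.
      move=> j; have [jk|_] := ltnP j k; last by exists 0%N.
      by have [m mP] := IH j jk; exists m.
    exists (\max_(j < k) m j) => g g' gg' j jk; apply: (mP j jk) => n nm.
    apply: gg'; apply: leq_trans nm _.
    exact: (leq_bigmax (F := fun j : 'I_k => m j) (Ordinal jk)).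
  have [n an] := bcof _ (ac k).
  exists (maxn M n.+1) => g g' gg'.
  have pre : prefix g k = prefix g' k.
    apply: eq_prefix; apply: MP => l lM; apply: gg'.
    by rewrite leq_max lM.
  have [U LU Ux] := (xc g).2.2 _ (bc n).
  have [U' LU' U'x] := (xc g').2.2 _ (bc n).
  have UU' : U = U'.
    rewrite -(hP _ _ _ LU Ux) -(hP _ _ _ LU' U'x) gg'//.
    by rewrite leq_max ltnSn orbT.
  have [T LT UT] := level_refine an LU.
  have : N (prefix g k.+1) = N (prefix g' k.+1).
    rewrite -(level_uniq LT (NL g k).1 (UT _ Ux) (NL g k).2).
    apply: (level_uniq LT (NL g' k).1 _ (NL g' k).2).
    by apply: UT; rewrite UU'.
  rewrite /= pre; case: (g k); case: (g' k) => // /eqP; first by rewrite (negPf (NN _)).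
  by rewrite eq_sym (negPf (NN _)).
(* Conversely, the node at a level [a k] not before [bc n] determines the member at level [bc n], so
   [k.+1] digits suffice. *)
- move=> n; have [k nk] := acof _ (bc n).
  exists k.+1 => g g' gg'.
  have [U LU NU] := level_refine nk (NL g k).1.
  rewrite (hP g n U LU); last exact/NU/(NL g k).2.
  apply/esym/hP => //; apply: NU; rewrite (eq_prefix gg').
  exact: (NL g' k).2.
- move=> g n; have [U LU Ux] := (xc g).2.2 _ (bc n).
  by rewrite (hP _ _ _ LU Ux).
Qed.

End Levels.

Theorem theorem1p1 (X : topologicalType) (mu : cardinal) :
  crowded X -> feebly_compact X -> pi_regular X ->
  (forall L : cardinal, card_lt L (hat_c X) -> Phi L mu) ->
  resolvable X mu.
Proof.
move=> X_crowded X_fc X_pi PhiX; apply: resolvable_local => U Uo.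
have [G [Go GU Gh]] := homogeneous_subset Uo.
exists G; split=> //.
(* [set (set X)] does not inject into [set X], so levels indexed by it run out. *)
have [lt lt_wo] := strict_well_order_exists (set (set X)).
have [L LP] := levels_exist lt_wo G.
apply: (levels_resolvable_on lt_wo LP) => // f.
exact: powerset_not_injective.
Qed.
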